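(* Let $\Pi_0\colon M\to N$ be a surjective map (of constant rank, between smooth manifolds). Suppose that a Lie group $G$ acts on $M$ and that $H\subset G$ is a proper subgroup whose action on $M$ is $\Pi_0$-projectable. For each $g\in G$, define the $g$-transformed surjective map $\Pi_g=\Pi_0\circ g^{-1}\colon M\to N$. Then the action of the conjugate subgroup $H_g=gHg^{-1}\subset G$ on $M$ is $\Pi_g$-projectable.
   Context: A group action of $H$ on $M$ is called projectable under a surjective map $\Pi\colon M\to N$ (or $\Pi$-projectable) if for all $v\in N$ and all $h\in H$ there exists $\bar v\in N$ such that $h\cdot\Pi^{-1}\{v\}=\Pi^{-1}\{\bar v\}$. In $\Pi_0\circ g^{-1}$, $g^{-1}$ denotes the transformation $z\mapsto g^{-1}\cdot z$ of $M$. *)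

(* Defs.v *)
From HB Require Import structures.
From mathcomp Require Import all_boot all_order all_algebra.
From mathcomp Require Import boolp classical_sets functions cardinality reals.
From mathcomp Require Import topology normedtype derive.

Set Implicit Arguments.
Unset Strict Implicit.
Unset Printing Implicit Defensive.

Import GRing.Theory Num.Theory numFieldNormedType.Exports.

Local Open Scope classical_set_scope.
Local Open Scope ring_scope.

(* [U] is meant to be open. A function is C^k on U iff it is differentiable on
   U with all its directional derivatives C^(k-1) on U. *)
Fixpoint Ck_on (R : realType) (m n k : nat) (U : set 'rV[R]_m)
    (f : 'rV[R]_m -> 'rV[R]_n) : Prop :=
  if k is k'.+1 then
    (forall x, U x -> differentiable f x) /\
    (forall v : 'rV[R]_m, Ck_on k' U (fun x => 'D_v f x))
  else forall x, U x -> {for x, continuous f}.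

Definition smooth_on (R : realType) (m n : nat) (U : set 'rV[R]_m)
    (f : 'rV[R]_m -> 'rV[R]_n) : Prop := forall k, Ck_on k U f.

(* [chart_map] and [chart_inv] are total functions; only their restrictions to
   [chart_dom] and [chart_codom] are relevant. *)
Record chart (R : realType) (T : topologicalType) (n : nat) := Chart {
  chart_dom : set T;
  chart_map : T -> 'rV[R]_n;
  chart_inv : 'rV[R]_n -> T;
  chart_codom := chart_map @` chart_dom;
  chart_dom_open : open chart_dom;
  chart_codom_open : open chart_codom;
  chart_mapK : forall x, chart_dom x -> chart_inv (chart_map x) = x;
  chart_map_continuous :
    forall x, chart_dom x -> {for x, continuous chart_map};
  chart_inv_continuous :
    forall z, chart_codom z -> {for z, continuous chart_inv}
}.

(* The atlas need not be maximal: the notions below that depend on it give the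
   same result for the maximal atlas it generates. *)
HB.mixin Record isManifold (R : realType) T of Topological T := {
  mdim : nat;
  atlas : set (chart R T mdim);
  manifold_hausdorff : hausdorff_space T;
  manifold_second_countable : @second_countable T;
  atlas_cover : forall x : T, exists2 a, atlas a & chart_dom a x;
  atlas_compatible : forall a b, atlas a -> atlas b ->
    smooth_on (chart_codom a `&` chart_inv a @^-1` chart_dom b)
              (chart_map b \o chart_inv a)
}.

#[short(type="manifoldType")]
HB.structure Definition Manifold (R : realType) :=
  {T of Topological T & isManifold R T}.

Definition smooth (R : realType) (A B : manifoldType R) (f : A -> B) : Prop :=
  continuous f /\
  forall (a : chart R A mdim) (b : chart R B mdim), atlas a -> atlas b ->
    smooth_on (chart_codom a `&` (f \o chart_inv a) @^-1` chart_dom b)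
              (chart_map b \o f \o chart_inv a).

(* Smoothness of (x, y) |-> f x y on the product manifold A x B, written in the
   product charts, whose coordinates are the row vectors (z_A | z_B). *)
Definition smooth2 (R : realType) (A B C : manifoldType R) (f : A -> B -> C)
    : Prop :=
  continuous (fun p : A * B => f p.1 p.2) /\
  forall (a : chart R A mdim) (b : chart R B mdim) (c : chart R C mdim),
    atlas a -> atlas b -> atlas c ->
    let f' := fun z => f (chart_inv a (lsubmx z)) (chart_inv b (rsubmx z)) in
    smooth_on [set z | [/\ chart_codom a (lsubmx z), chart_codom b (rsubmx z)
                         & chart_dom c (f' z)]]
              (chart_map c \o f').

Definition constant_rank (R : realType) (A B : manifoldType R) (f : A -> B)
    : Prop :=
  exists r : nat, forall (x : A) (a : chart R A mdim) (b : chart R B mdim),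
    atlas a -> atlas b -> chart_dom a x -> chart_dom b (f x) ->
    \rank ('J (chart_map b \o f \o chart_inv a) (chart_map a x)) = r.

HB.mixin Record isLieGroup (R : realType) T of Manifold R T & Group T := {
  mulg_smooth : smooth2 (fun x y : T => (x * y)%g);
  invg_smooth : smooth (fun x : T => (x^-1)%g)
}.

#[short(type="lieGroupType")]
HB.structure Definition LieGroup (R : realType) :=
  {T of Manifold R T & Group T & isLieGroup R T}.

Record lie_action (R : realType) (G : lieGroupType R) (M : manifoldType R) :=
  LieAction {
    act :> G -> M -> M;
    act1 : forall x, act 1%g x = x;
    actM : forall g h x, act (g * h)%g x = act g (act h x);
    act_smooth : smooth2 act
  }.

Definition projectable (R : realType) (G : lieGroupType R)
    (M N : manifoldType R) (phi : lie_action G M) (H : set G) (Pi : M -> N)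
    : Prop :=
  set_surj [set: M] [set: N] Pi /\
  forall v : N, forall h : G, H h ->
    exists v' : N, phi h @` (Pi @^-1` [set v]) = Pi @^-1` [set v'].

Definition conj_subgroup (R : realType) (G : lieGroupType R) (g : G)
    (H : set G) : set G := [set (g * h * g^-1)%g | h in H].

Definition transformed_map (R : realType) (G : lieGroupType R)
    (M N : manifoldType R) (phi : lie_action G M) (g : G) (Pi : M -> N)
    : M -> N := Pi \o phi (g^-1)%g.

(* Main.v *)
(* The fibers of Pi_g are the g-translates of the fibers of Pi_0, and
   (g h g^-1) . (g . F) = g . (h . F). *)
Require Import Defs.
From mathcomp Require Import all_boot all_order all_algebra.
From mathcomp Require Import boolp classical_sets functions reals topology.

Local Open Scope classical_set_scope.

(** Translation by [g] carries the [Pi0]-fiber over each [v] onto the transformed fiber over the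
    same [v] ([preimage_transformed_map]). Hence [g * h * g^-1] moves the new fibers exactly as [h]
    moves the old ones, with the same target point [v']. *)

Lemma lie_actK (R : realType) (G : lieGroupType R) (M : manifoldType R)
  (phi : lie_action G M) (g : G) : cancel (phi g) (phi g^-1%g).
Proof. by move=> x; rewrite -actM mulVg act1. Qed.

Lemma lie_actKV (R : realType) (G : lieGroupType R) (M : manifoldType R)
  (phi : lie_action G M) (g : G) : cancel (phi g^-1%g) (phi g).
Proof. by move=> x; rewrite -actM mulgV act1. Qed.

Lemma image_lie_actM (R : realType) (G : lieGroupType R) (M : manifoldType R)
  (phi : lie_action G M) (g h : G) (A : set M) :
  phi (g * h)%g @` A = phi g @` (phi h @` A).
Proof. by rewrite image_comp; congr image; apply/funext => x; exact: actM. Qed.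

(** Since [g^-1] acts as the two-sided inverse of [g], pulling back along it is pushing forward
    along [g]. *)
Lemma preimage_transformed_map (R : realType) (G : lieGroupType R)
  (M N : manifoldType R) (phi : lie_action G M) (g : G) (Pi : M -> N)
  (A : set N) :
  transformed_map phi g Pi @^-1` A = phi g @` (Pi @^-1` A).
Proof.
apply/seteqP; split => [x Ax|_ [x Ax <-]].
  by exists (phi g^-1%g x) => //; rewrite lie_actKV.
by rewrite /preimage /transformed_map /= lie_actK.
Qed.

Theorem theorem13 (R : realType) (M N : manifoldType R) (G : lieGroupType R)
  (phi : lie_action G M) (Pi0 : M -> N)
  (Pi0_smooth : smooth Pi0) (Pi0_rank : constant_rank Pi0)
  (Pi0_surj : set_surj [set: M] [set: N] Pi0)
  (H : set G) (H_subgroup : group_closed (mem H)) (H_proper : H `<` [set: G])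
  (H_proj : projectable phi H Pi0) (g : G) :
  projectable phi (conj_subgroup g H) (transformed_map phi g Pi0).
Proof.
split=> [v _|v _ [h Hh <-]].
  have [x _ <-] := Pi0_surj v I.
  by exists (phi g x) => //; rewrite /transformed_map /= lie_actK.
have [v' Ev'] := H_proj.2 v h Hh.
(* Both sides are now images of the [Pi0]-fiber over [v], under [g * h * g^-1 * g] and [g * h]. *)
exists v'; rewrite !preimage_transformed_map -Ev' -!image_lie_actM.
by rewrite -!mulgA mulVg mulg1.
Qed.
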